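(* Let $p,q\ge2$. The topology of the horoboundary $\partial\,\mathrm{DL}(p,q)$ is as follows: - $\rho_{x_0}$ ($x_0\in T$) and $\rho'_{x'_0}$ ($x_0'\in T'$) are isolated points. - $\rho_i\to\rho_{\omega_0}$ if $i\to\infty$, and $\rho_i\to\rho'_{\omega'_0}$ if $i\to-\infty$. - $\rho_{\omega_n}\to\rho_\omega$ if $\omega_n\to\omega$ in $\partial T$, and $\rho'_{\omega'_n}\to\rho'_{\omega'}$ if $\omega_n'\to\omega'$ in $\partial T'$. - $\rho_{x_0}\to\rho_\omega$ if $x_0\to\omega$, where $\omega\in\partial T$, $\omega\ne\omega_0$. - $\rho_{x_0}\to\rho_{\omega_0}$ if $x_0\to\omega_0$ and $h(x_0)\to+\infty$. - $\rho_{x_0}\to\rho'_{\omega_0'}$ if $x_0\to\omega_0$ and $h(x_0)\to-\infty$. - $\rho_{x_0}\to\rho_i$ if $x_0\to\infty$ in $T$ (i.e. $d(x_0,o)\to\infty$) with $h(x_0)=i$ fixed. The analogous statements (exchanging the roles of $T$ and $T'$) hold for $\rho'_{x_0'}$. Also, every sequence of distinct points of $\partial\,\mathrm{DL}(p,q)$ has a subsequence of one of these types.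
   Context: $T,T'$ are the $(p+1)$-regular and $(q+1)$-regular trees with fixed vertices $o,o'$ and fixed ends $\omega_0\in\partial T$, $\omega_0'\in\partial T'$; $x_0\to\omega$ is convergence in the end compactification, for a sequence of vertices $x_0$ varying in $T$. For $u,v\in T$, $u\wedge v$ is the common vertex of the geodesics $uv$, $u\omega_0$, $v\omega_0$, and $h(u)=d(u,u\wedge o)-d(o,u\wedge o)$; $\wedge$ and $h'$ on $T'$ are defined similarly. $\mathrm{DL}(p,q)$ has vertex set $\{(v,v')\in T\times T':h(v)+h'(v')=0\}$, with $(v,v')\sim(w,w')$ iff $v\sim w$ and $v'\sim w'$, and the graph distance. The horoboundary $\partial\,\mathrm{DL}(p,q)$ consists of the following functions modulo additive constants, with the topology of pointwise convergence of the representatives vanishing at $(o,o')$: $\rho_\omega(y,y')=\lim_{x\to\omega}(d(y,x)-d(o,x))$ for $\omega\in\partial T$; $\rho'_{\omega'}(y,y')=\lim_{x'\to\omega'}(d(y',x')-d(o',x'))$ for $\omega'\in\partial T'$; $\rho_{x_0}(y,y')=-2h(y\wedge x_0)-|h(y)-h(x_0)|$ for $x_0\in T$; $\rho'_{x'_0}(y,y')=-2h'(y'\wedge x'_0)-|h'(y')-h'(x_0')|$ for $x'_0\in T'$; $\rho_i(y,y')=-|h(y)-i|=-|h'(y')+i|$ for $i\in\mathbb Z$. *)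

(* Defs.v *)
From HB Require Import structures.
From mathcomp Require Import all_boot all_order all_algebra.
From mathcomp Require Import all_classical all_reals all_analysis.
Set Implicit Arguments.
Unset Strict Implicit.
Unset Printing Implicit Defensive.
Import Order.TTheory GRing.Theory Num.Theory.
Import numFieldNormedType.Exports.
Local Open Scope classical_set_scope.
Local Open Scope ring_scope.

(* Trees are possibly infinite, connected, acyclic simple graphs.  [ucycle]
   also accepts the degenerate cycles [::] and [:: x; y] with x ~ y, hence the
   bound 2 in [tree_acyclic]. *)
Structure tree := Tree {
  vertex :> choiceType;
  adj : rel vertex;
  tree_sym : symmetric adj;
  tree_irr : irreflexive adj;
  tree_connected : forall u v, exists2 s, path adj u s & last u s = v;
  tree_acyclic : forall c : seq vertex, ucycle adj c -> (size c <= 2)%N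
}.

Definition regular (d : nat) (T : tree) : Prop :=
  forall u : T, exists s : seq T,
    [/\ uniq s, size s = d & forall v, (v \in s) = adj u v].

Section TreeGeometry.
Variable T : tree.
Implicit Types (u v x : T) (r s : nat -> T) (K : seq T).

Definition is_dist u v (n : nat) : Prop :=
  (exists2 s : seq T, path (@adj T) u s & last u s = v /\ size s = n) /\
  (forall s : seq T, path (@adj T) u s -> last u s = v -> (n <= size s)%N).

Definition dist u v : nat := xget 0%N [set n | is_dist u v n].

(* In a tree the injective infinite paths are exactly the geodesic rays. *)
Definition ray r : Prop := (forall n, adj (r n) (r n.+1)) /\ injective r.

Definition ray_equiv r s : Prop :=
  exists a b : nat, forall n, r (n + a)%N = s (n + b)%N.

Definition tree_end : Type :=
  {E : set (nat -> T) |
    exists2 r, ray r & E = [set s | ray s /\ ray_equiv r s]}.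

Implicit Types (w : tree_end).

Definition on_geodesic u v x : Prop := (dist u x + dist x v = dist u v)%N.

Definition on_geodesic_ray u w x : Prop :=
  exists r, [/\ sval w r, r 0%N = u & exists n, r n = x].

Definition same_component K u v : Prop :=
  exists2 s : seq T, path (@adj T) u s &
    last u s = v /\ all (fun z => z \notin K) (u :: s).

(* The component of the complement of the finite set K in which w lives.  As K
   varies, these components, together with the ends living in them, form a
   neighborhood basis of w in the end compactification. *)
Definition component_at K w : set T :=
  [set x | exists2 r, sval w r & \forall n \near \oo, same_component K x (r n)].

Definition ends_at K w : set tree_end :=
  [set w' | exists2 r, sval w' r & \forall n \near \oo, component_at K w (r n)].

(* Traces on T and on the space of ends of the neighborhood filter of w. *)
Definition to_end w : set_system T :=
  filter_from setT (fun K => component_at K w).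

Definition ends_to_end w : set_system tree_end :=
  filter_from setT (fun K => ends_at K w).

(* The geodesics uv, u w0 and v w0 have exactly one common vertex. *)
Definition meet w0 u v : T :=
  xget u [set x | [/\ on_geodesic u v x, on_geodesic_ray u w0 x
                    & on_geodesic_ray v w0 x]].

Definition height (o : T) w0 u : int :=
  (dist u (meet w0 u o))%:Z - (dist o (meet w0 u o))%:Z.

Lemma height_root o w0 : height o w0 o = 0.
Proof. exact: subrr. Qed.

End TreeGeometry.

Section TreeFunctions.
Variables (R : realType) (T : tree) (o : T) (w0 : tree_end T).

Definition busemann (w : tree_end T) (u : T) : R :=
  lim (((dist u x)%:R - (dist o x)%:R : R) @[x --> to_end w]).

Definition vertex_fun (x0 u : T) : R :=
  (- (2 * height o w0 (meet w0 u x0))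
   - `|height o w0 u - height o w0 x0|)%:~R.

Definition level_fun (i : int) (u : T) : R := (- `|height o w0 u - i|)%:~R.

End TreeFunctions.

Definition DL (T T' : tree) (o : T) (w0 : tree_end T)
    (o' : T') (w0' : tree_end T') : Type :=
  {y : T * T' | height o w0 y.1 + height o' w0' y.2 = 0}.

Section Horoboundary.
Variables (R : realType) (T T' : tree).
Variables (o : T) (w0 : tree_end T) (o' : T') (w0' : tree_end T').

Local Notation DL := (DL o w0 o' w0').

Lemma DL_root_subproof :
  height o w0 (o, o').1 + height o' w0' (o, o').2 = 0.
Proof. by rewrite !height_root addr0. Qed.

Definition DL_root : DL := exist _ (o, o') DL_root_subproof.

(* A function modulo additive constants is identified with its representative
   vanishing at the root; these carry the topology of pointwise convergence. *)
Definition normalize (f : DL -> R) : {ptws DL -> R} :=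
  fun y => f y - f DL_root.

Definition rho_end (w : tree_end T) : {ptws DL -> R} :=
  normalize (fun y => busemann R o w (sval y).1).

Definition rho_end' (w' : tree_end T') : {ptws DL -> R} :=
  normalize (fun y => busemann R o' w' (sval y).2).

Definition rho_vertex (x0 : T) : {ptws DL -> R} :=
  normalize (fun y => vertex_fun R o w0 x0 (sval y).1).

Definition rho_vertex' (x0' : T') : {ptws DL -> R} :=
  normalize (fun y => vertex_fun R o' w0' x0' (sval y).2).

Definition rho_level (i : int) : {ptws DL -> R} :=
  normalize (fun y => level_fun R o w0 i (sval y).1).

Definition horoboundary : set {ptws DL -> R} :=
  range rho_end `|` range rho_end' `|` range rho_vertex
    `|` range rho_vertex' `|` range rho_level.

(* [limit_type s l]: the sequence s of boundary points is of one of the types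
   in the description of the topology, and l is the limit claimed for it.  The
   function rho_level i is -|h' + i| in terms of T', hence the sign in
   [lim_vertex'_level]. *)
Inductive limit_type : (nat -> {ptws DL -> R}) -> {ptws DL -> R} -> Prop :=
| lim_level_pinfty (i : nat -> int) of
    ((i n)%:~R : R) @[n --> \oo] --> +oo :
    limit_type (fun n => rho_level (i n)) (rho_end w0)
| lim_level_ninfty (i : nat -> int) of
    ((i n)%:~R : R) @[n --> \oo] --> -oo :
    limit_type (fun n => rho_level (i n)) (rho_end' w0')
| lim_end (w_ : nat -> tree_end T) (w : tree_end T) of
    w_ @ \oo --> ends_to_end w :
    limit_type (fun n => rho_end (w_ n)) (rho_end w)
| lim_end' (w_ : nat -> tree_end T') (w : tree_end T') of
    w_ @ \oo --> ends_to_end w :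
    limit_type (fun n => rho_end' (w_ n)) (rho_end' w)
| lim_vertex_end (x : nat -> T) (w : tree_end T) of
    x @ \oo --> to_end w & w <> w0 :
    limit_type (fun n => rho_vertex (x n)) (rho_end w)
| lim_vertex_pinfty (x : nat -> T) of
    x @ \oo --> to_end w0 &
    ((height o w0 (x n))%:~R : R) @[n --> \oo] --> +oo :
    limit_type (fun n => rho_vertex (x n)) (rho_end w0)
| lim_vertex_ninfty (x : nat -> T) of
    x @ \oo --> to_end w0 &
    ((height o w0 (x n))%:~R : R) @[n --> \oo] --> -oo :
    limit_type (fun n => rho_vertex (x n)) (rho_end' w0')
| lim_vertex_level (x : nat -> T) (i : int) of
    dist (x n) o @[n --> \oo] --> \oo &
    (forall n, height o w0 (x n) = i) :
    limit_type (fun n => rho_vertex (x n)) (rho_level i)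
| lim_vertex'_end (x : nat -> T') (w : tree_end T') of
    x @ \oo --> to_end w & w <> w0' :
    limit_type (fun n => rho_vertex' (x n)) (rho_end' w)
| lim_vertex'_pinfty (x : nat -> T') of
    x @ \oo --> to_end w0' &
    ((height o' w0' (x n))%:~R : R) @[n --> \oo] --> +oo :
    limit_type (fun n => rho_vertex' (x n)) (rho_end' w0')
| lim_vertex'_ninfty (x : nat -> T') of
    x @ \oo --> to_end w0' &
    ((height o' w0' (x n))%:~R : R) @[n --> \oo] --> -oo :
    limit_type (fun n => rho_vertex' (x n)) (rho_end w0)
| lim_vertex'_level (x : nat -> T') (i : int) of
    dist (x n) o' @[n --> \oo] --> \oo &
    (forall n, height o' w0' (x n) = i) :
    limit_type (fun n => rho_vertex' (x n)) (rho_level (- i)).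

End Horoboundary.

Arguments rho_end R {T T'} o w0 o' w0' w.
Arguments rho_end' R {T T'} o w0 o' w0' w'.
Arguments rho_vertex R {T T'} o w0 o' w0' x0.
Arguments rho_vertex' R {T T'} o w0 o' w0' x0'.
Arguments rho_level R {T T'} o w0 o' w0' i.
Arguments horoboundary R {T T'} o w0 o' w0'.

(* Main.v *)
(* Orient the tree towards an end w: every vertex has a parent, the next vertex
   on its ray to w, and distances are read off from the least common ancestor.
   The height relative to w is then the Busemann function of w, for every end w
   and not only for w0, and x_n -> w means that for every vertex m the x_n are
   eventually not descendants of m.  The function of a vertex x is, up to a
   constant, d(., x) - 2 max(h, h(x)), so that all limits follow from
   d(y, x_n) - d(o, x_n) being eventually equal to the height of y relative to
   the limit of (x_n).  Since the functions are integer valued, the function of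
   x0 is isolated by its values at four points of DL, lying over x0, a sibling
   of x0 and two children of x0.  Convergent subsequences come from Koenig's
   lemma. *)
Require Import Defs.
From HB Require Import structures.
From mathcomp Require Import all_boot all_order all_algebra.
From mathcomp Require Import all_classical all_reals all_analysis.
From mathcomp Require Import zify.
Set Implicit Arguments.
Unset Strict Implicit.
Unset Printing Implicit Defensive.
Import Order.TTheory GRing.Theory Num.Theory.
Import numFieldNormedType.Exports.
Local Open Scope classical_set_scope.
Local Open Scope ring_scope.

(** * Graph distance and uniqueness of simple paths *)

Section Distance.
Variable T : tree.
Implicit Types u v x y z : T.

(** [dist] is an [xget] with default value 0; connectedness supplies a path, hence a shortest one,
    so that the default is never met. *)
Lemma dist_path u v : is_dist u v (dist u v).
Proof.
apply: (@xgetPex _ 0%N [set n | is_dist u v n]).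
have [s ps ls] := tree_connected u v.
pose P n := `[< exists2 s : seq T, path (@adj T) u s &
  last u s = v /\ size s = n >].
have exP : exists n, P n by exists (size s); apply/asboolP; exists s.
case: (ex_minnP exP) => n /asboolP Pn minn; exists n; split => //.
by move=> t pt lt; apply: minn; apply/asboolP; exists t.
Qed.

Lemma dist_le u (s : seq T) :
  path (@adj T) u s -> (dist u (last u s) <= size s)%N.
Proof. by move=> ps; case: (dist_path u (last u s)) => _; apply. Qed.

Lemma distuu u : dist u u = 0%N.
Proof. by apply/eqP; rewrite -leqn0; apply: (@dist_le u [::]). Qed.

Lemma dist_eq0 u v : dist u v = 0%N -> u = v.
Proof.
move=> d0; case: (dist_path u v) => -[s _ [ls]].
by rewrite d0 => /size0nil s0; rewrite -ls s0.
Qed.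

Lemma dist_triangle v u x : (dist u x <= dist u v + dist v x)%N.
Proof.
case: (dist_path u v) => -[s ps [ls <-]] _.
case: (dist_path v x) => -[t pt [lt <-]] _.
rewrite -lt -ls -last_cat -size_cat; apply: dist_le.
by rewrite cat_path ps ls.
Qed.

Lemma adj_dist u v : adj u v -> (dist u v <= 1)%N.
Proof. by move=> uv; apply: (@dist_le u [:: v]); rewrite /= uv. Qed.

Lemma distC u v : dist u v = dist v u.
Proof.
suff le x y : (dist x y <= dist y x)%N by apply/eqP; rewrite eqn_leq !le.
case: (dist_path y x) => -[s ps [ls <-]] _.
have -> : size s = size (rev (belast y s)) by rewrite size_rev size_belast.
have e : last x (rev (belast y s)) = y.
  by case: s {ps} ls => [|a s] //= _; rewrite rev_cons last_rcons.
have /dist_le : path (@adj T) x (rev (belast y s)).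
  by rewrite -ls rev_path (@eq_path _ _ (@adj T)) // => a b; apply: tree_sym.
by rewrite e.
Qed.

Lemma dist_step u v : u <> v ->
  exists2 z, adj u z & dist u v = (dist z v).+1.
Proof.
move=> uv; case: (dist_path u v) => -[[|z s] /= ps [ls ds]] _ //.
case/andP: ps => uz ps; exists z => //; apply/eqP; rewrite eqn_leq.
have := dist_triangle z u v; have := adj_dist uz.
have := dist_le ps; rewrite ls; lia.
Qed.

(** Where the paths diverge, following [s] up to its first vertex on [t] and returning along [t]
    closes a cycle, which acyclicity forbids. *)
Lemma uniq_path_eq u (s t : seq T) :
  path (@adj T) u s -> path (@adj T) u t -> uniq (u :: s) -> uniq (u :: t) ->
  last u s = last u t -> s = t.
Proof.
elim: s u t => [|a s IH] u [|b t] //.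
- by move=> _ _ _ /= /andP[+ _] e; rewrite e mem_last.
- by move=> _ _ /= /andP[+ _] _ e; rewrite -e mem_last.
have [<-{b}|ab] := eqVneq a b.
  move=> /= /andP[_ ps] /andP[_ pt] /andP[_ us] /andP[_ ut] e.
  by rewrite (IH a t).
move=> ps pt us ut le; exfalso.
have hs : has (mem (b :: t)) (a :: s).
  apply/hasP; exists (last a s); first exact: mem_last.
  by move: le => /= ->; exact: mem_last.
move: ab ps us; case: {-1}_ _ _ / (split_find hs) (erefl (a :: s)).
move=> x s1 s2 xt ns1 es ab.
have [t1 [t2 et]] : exists t1 t2, b :: t = t1 ++ x :: t2.
  by case/splitPr: xt => t1 t2; exists t1, t2.
rewrite et in pt ut ns1 => ps us.
have := @tree_acyclic T (u :: rcons s1 x ++ rev t1); rewrite /ucycle.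
rewrite /= size_cat size_rcons size_rev => H.
(* A cycle of size at most 2 leaves [s1] and [t1] empty, so that [a] and [b] are both [x], against
   [ab]. *)
suff: (((size s1).+1 + size t1).+1 <= 2)%N.
  rewrite addSn !ltnS leqn0 addn_eq0 !size_eq0 => /andP[/eqP s10 /eqP t10].
  by move: es et ab; rewrite s10 t10 /= => -[-> _] [<- _]; rewrite eqxx.
apply: H; apply/andP; split.
  rewrite rcons_cat cat_path.
  move: ps; rewrite cat_path => /andP[ps _]; rewrite ps last_rcons /=.
  move: pt; rewrite -cat_rcons cat_path => /andP[pt _].
  have := rev_path (@adj T) u (rcons t1 x).
  rewrite last_rcons belast_rcons rev_cons => ->.
  by rewrite (@eq_path _ _ (@adj T)) // => a' b'; apply: tree_sym.
move: ut us; rewrite /= !mem_cat !cat_uniq rcons_uniq !mem_rcons !inE !mem_rev.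
rewrite !negb_or.
move=> /and4P[/and3P[ut1 ux _] u1 /andP[xt1 _] _].
move=> /and4P[/andP[/andP[_ us1] _] /andP[xs1 us] _ _].
rewrite ux us1 ut1 xs1 us rev_uniq u1 !andbT /=.
apply/hasPn => z; rewrite mem_rev mem_rcons inE => zt1; rewrite negb_or.
have -> /= : z != x by apply: contraNneq xt1 => <-.
apply: contra ns1 => zs1; apply/hasP; exists z => //=.
by rewrite mem_cat zt1.
Qed.

End Distance.

(** * Rays and their equivalence *)

Section Rays.
Variable T : tree.
Implicit Types (u v x : T) (r s t : nat -> T).

Lemma ray_equiv_sym r s : ray_equiv r s -> ray_equiv s r.
Proof. by move=> [a [b E]]; exists b, a => n; rewrite E. Qed.

Lemma ray_equiv_trans s r t : ray_equiv r s -> ray_equiv s t -> ray_equiv r t.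
Proof.
move=> [a [b E]] [c [d F]]; exists (a + c)%N, (b + d)%N => n.
have -> : (n + (a + c) = (n + c) + a)%N by lia.
rewrite E; have -> : (n + c + b = (n + b) + c)%N by lia.
by rewrite F; congr t; lia.
Qed.

Definition prefix_seq r n := mkseq (fun i => r i.+1) n.

Lemma prefix_path r n : (forall n, adj (r n) (r n.+1)) ->
  path (@adj T) (r 0%N) (prefix_seq r n) /\ last (r 0%N) (prefix_seq r n) = r n.
Proof.
move=> ar; rewrite /prefix_seq; elim: n => [|n [IH1 IH2]] //.
by rewrite mkseqS rcons_path IH1 IH2 ar last_rcons.
Qed.

Lemma prefix_uniq r n : injective r -> uniq (r 0%N :: prefix_seq r n).
Proof.
move=> ir; have -> : r 0%N :: prefix_seq r n = map r (iota 0 n.+1).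
  by rewrite /prefix_seq /mkseq /= (iotaDl 1 0) -map_comp.
by rewrite map_inj_uniq ?iota_uniq.
Qed.

(** The prefixes of lengths [n + a] and [n + b] are simple paths with the same endpoints, hence
    equal; their lengths give [a = b]. *)
Lemma ray_unique r s :
  ray r -> ray s -> r 0%N = s 0%N -> ray_equiv r s -> r = s.
Proof.
move=> [ar ir] [as_ is_] e0 [a [b E]].
have P n : prefix_seq r (n + a) = prefix_seq s (n + b).
  have [p1 l1] := prefix_path (n + a) ar.
  have [p2 l2] := prefix_path (n + b) as_.
  apply: (@uniq_path_eq _ (r 0%N)) => //; rewrite ?prefix_uniq //.
  - by rewrite e0.
  - by rewrite e0 prefix_uniq.
  - by rewrite l1 e0 l2 E.
have ab : a = b by have := congr1 size (P 0%N); rewrite !size_mkseq; lia.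
apply/funext => -[|k] //.
have := congr1 (nth (r 0%N) ^~ k) (P k.+1) => /=.
by rewrite !nth_mkseq //; lia.
Qed.

End Rays.

(** * Orientation of the tree towards a fixed end *)

Section Ends.
Variables (T : tree) (w : tree_end T).
Implicit Types (u v x y z m : T) (r s : nat -> T).

Lemma end_inhabited : exists r, sval w r.
Proof.
case: w => E [r rr EE] /=; exists r; rewrite EE; split => //.
by exists 0%N, 0%N.
Qed.

Lemma end_ray r : sval w r -> ray r.
Proof. by case: w => E [s ss EE] /=; rewrite EE => -[]. Qed.

Lemma end_equiv r s : sval w r -> sval w s -> ray_equiv r s.
Proof.
case: w => E [t tt EE] /=; rewrite EE => -[_ tr] [_ ts].
by apply: ray_equiv_trans ts; exact: ray_equiv_sym.
Qed.

Lemma end_closed r s : sval w r -> ray s -> ray_equiv r s -> sval w s.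
Proof.
case: w => E [t tt EE] /=; rewrite EE => -[_ tr] rs e; split => //.
exact: ray_equiv_trans e.
Qed.

Lemma end_shift r k : sval w r -> sval w (fun n => r (n + k)%N).
Proof.
move=> wr; apply: (end_closed wr); have [ar ir] := end_ray wr.
  by split=> [n|a b /ir /addIn]; first exact: ar.
by exists k, 0%N => n; rewrite addn0.
Qed.

Lemma end_cons r u : sval w r -> adj u (r 0%N) -> (forall n, r n <> u) ->
  sval w (fun n => if n is k.+1 then r k else u).
Proof.
move=> wr ur nu; apply: (end_closed wr); have [ar ir] := end_ray wr.
  split=> [[|n]|[|a] [|b]] //.
  - by move=> e; case: (nu b).
  - by move=> e; case: (nu a).
  - by move/ir ->.
by exists 0%N, 1%N => n; rewrite addn0 addn1.
Qed.

(** Going back along a path from [u] to some ray of [w], each new vertex either lies on the current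
    ray, which is cut there, or can be prepended to it. *)
Lemma end_from u : exists2 r, sval w r & r 0%N = u.
Proof.
have [r wr] := end_inhabited; have [s] := tree_connected u (r 0%N).
elim: s u => [|a s IH] u /=; first by move=> _ ->; exists r.
move=> /andP[ua ps] /(IH _ ps)[t wt ta].
case: (pselect (exists n, t n = u)) => [[n tn]|nt].
  by exists (fun k => t (k + n)%N) => //; exact: end_shift.
exists (fun n => if n is k.+1 then t k else u) => //.
apply: end_cons => //; first by rewrite ta.
by move=> n tn; apply: nt; exists n.
Qed.

Definition ray_from u : nat -> T := s2val (cid2 (end_from u)).

Lemma ray_from_end u : sval w (ray_from u).
Proof. exact: (s2valP (cid2 (end_from u))). Qed.

Lemma ray_from0 u : ray_from u 0%N = u.
Proof. exact: (s2valP' (cid2 (end_from u))). Qed.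

Lemma ray_fromE r : sval w r -> ray_from (r 0%N) = r.
Proof.
move=> wr; apply: ray_unique; rewrite ?ray_from0 //.
- exact/end_ray/ray_from_end.
- exact: end_ray.
- by apply: end_equiv => //; exact: ray_from_end.
Qed.

Definition par u : T := ray_from u 1%N.

Lemma ray_from_iter u n : ray_from u n = iter n par u.
Proof.
elim: n => [|n IH] /=; first exact: ray_from0.
rewrite /par -IH.
have /ray_fromE := end_shift n (ray_from_end u).
by rewrite /= add0n => ->; rewrite add1n.
Qed.

Lemma iter_par_inj u : injective (fun n => iter n par u).
Proof.
by have [_] := end_ray (ray_from_end u) => i a b; rewrite -!ray_from_iter => /i.
Qed.

Lemma iter_par_end u : sval w (fun n => iter n par u).
Proof.
suff <- : ray_from u = (fun n => iter n par u) by exact: ray_from_end.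
by apply/funext => n; rewrite ray_from_iter.
Qed.

Lemma end_iterE r : sval w r -> forall n, r n = iter n par (r 0%N).
Proof. by move=> /ray_fromE e n; rewrite -ray_from_iter e. Qed.

Lemma adj_par u : adj u (par u).
Proof.
have [a _] := end_ray (iter_par_end u); exact: (a 0%N).
Qed.

(** If [v] is on the ray from [u], uniqueness of simple paths makes it the second vertex of that
    ray; otherwise [v] can be prepended to it. *)
Lemma adjP u v : adj u v -> v = par u \/ u = par v.
Proof.
move=> uv; case: (pselect (exists n, iter n par u = v)) => [[n nv]|nv].
  left; case: n nv => [|n] nv; first by move: uv; rewrite -nv tree_irr.
  have [a i] := end_ray (iter_par_end u).
  have [p l] := prefix_path n.+1 a; have := prefix_uniq n.+1 i.
  move=> un; suff : prefix_seq (fun n => iter n par u) n.+1 = [:: v].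
    by rewrite /prefix_seq /mkseq /= => -[].
  have uniq_uv : uniq [:: u; v].
    by rewrite /= inE andbT; apply: contraTneq uv => ->; rewrite tree_irr.
  apply: (uniq_path_eq p _ un uniq_uv); rewrite /= ?uv //.
  by rewrite -nv -l.
right; have e : sval w (fun n => if n is k.+1 then iter k par u else v).
  apply: end_cons; [exact: iter_par_end|by rewrite tree_sym|].
  by move=> n nu; apply: nv; exists n.
by have /= := end_iterE e 1%N.
Qed.

Lemma common_ancestor u v : exists a b, iter a par u = iter b par v.
Proof.
have [a [b E]] := end_equiv (iter_par_end u) (iter_par_end v).
by exists a, b; exact: (E 0%N).
Qed.

Lemma dist_iter_le u n : (dist u (iter n par u) <= n)%N.
Proof.
have [a _] := end_ray (iter_par_end u); have [p l] := prefix_path n a.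
by have := dist_le p; rewrite l size_mkseq.
Qed.

(** Both [a' + b] and [a + b'] steps from [v] lead to the vertex [a + a'] steps above [u], and the
    ray from [v] is injective. *)
Lemma iter_par_balance u v a b a' b' : iter a par u = iter b par v ->
  iter a' par u = iter b' par v -> (a' + b = a + b')%N.
Proof.
move=> e e'; apply: (@iter_par_inj v).
by rewrite iterD -e -iterD addnC iterD e' -iterD.
Qed.

(** Every path yields a common ancestor with [a + b] at most its length, and every common ancestor
    bounds the distance. Since [a - b] is the same for all of them, a minimal sum makes both terms
    minimal. *)
Lemma distP u v : exists a b, [/\ iter a par u = iter b par v,
  dist u v = (a + b)%N &
  forall a' b', iter a' par u = iter b' par v ->
    [/\ (a <= a')%N, (b <= b')%N & (a' + b = a + b')%N]].
Proof.
(* Prepending a step up to the parent increments [a]; prepending a step down decrements [a] or, if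
   [a] is 0, increments [b]. *)
have low (s : seq T) x : path (@adj T) x s -> exists a b,
    iter a par x = iter b par (last x s) /\ (a + b <= size s)%N.
  elim: s x => [|y s IH] x /=; first by exists 0%N, 0%N.
  move=> /andP[/adjP xy /IH[a [b [e le]]]]; case: xy => xy.
    by exists a.+1, b; rewrite iterSr -xy; split => //; lia.
  case: a e le => [|a] e le.
    by exists 0%N, b.+1; rewrite /= -e; split => //; lia.
  by exists a, b; rewrite xy -iterSr; split => //; lia.
have [[s ps [ls sz]] _] := dist_path u v.
have [a [b [e le]]] := low _ _ ps; rewrite ls in e.
have up a' b' : iter a' par u = iter b' par v -> (dist u v <= a' + b')%N.
  move=> e'; have := dist_triangle (iter a' par u) u v.
  have := dist_iter_le u a'.
  have := dist_iter_le v b'; rewrite -e' distC; lia.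
exists a, b; split=> [//||a' b' e'].
  by have := up _ _ e; lia.
by have := up _ _ e'; have := iter_par_balance e e'; split; lia.
Qed.

Lemma dist_iter u n : dist u (iter n par u) = n.
Proof.
have [a [b [_ -> /(_ n 0%N erefl)]]] := distP u (iter n par u).
by case; lia.
Qed.

Lemma on_geodesic_rayP u x :
  on_geodesic_ray u w x <-> exists n, iter n par u = x.
Proof.
split=> [[r [wr r0 [n rn]]]|[n nx]].
  by exists n; rewrite -r0 -end_iterE.
by exists (fun n => iter n par u); split => //; [exact: iter_par_end|exists n].
Qed.

(** The least common ancestor satisfies the condition defining [meet]; conversely, a common ancestor
    on the geodesic takes [dist u v] steps in total, hence is the least one. *)
Lemma meetP u v : exists a b, [/\ iter a par u = meet w u v,
  iter b par v = meet w u v & dist u v = (a + b)%N].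
Proof.
have [a [b [e d le]]] := distP u v; exists a, b.
suff <- : iter a par u = meet w u v by split.
have /= [] := @xgetPex _ u [set x | [/\ on_geodesic u v x,
  on_geodesic_ray u w x & on_geodesic_ray v w x]].
  exists (iter a par u); split; last 2 first.
  - by apply/on_geodesic_rayP; exists a.
  - by apply/on_geodesic_rayP; exists b.
  by rewrite /on_geodesic dist_iter {1}e distC dist_iter d.
rewrite -/(meet w u v) => g /on_geodesic_rayP[n nu] /on_geodesic_rayP[k kv].
move: g; rewrite /on_geodesic -{1}nu dist_iter -{1}kv distC dist_iter.
rewrite -nu in kv *.
by have [] := le _ _ (esym kv) => ? ? ? ?; congr (iter _ par u); lia.
Qed.

Section Height.
Variable o : T.
Local Notation h := (height o w).

Lemma height_ancestor u a b : iter a par u = iter b par o -> h u = a%:Z - b%:Z.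
Proof.
move=> e; have [a' [b' [ea eb _]]] := meetP u o.
rewrite /height -{1}ea -eb !dist_iter.
have := iter_par_balance e (etrans ea (esym eb)); lia.
Qed.

Lemma height_iter u n : h (iter n par u) = h u - n%:Z.
Proof.
have [a [b e]] := common_ancestor u o.
rewrite (height_ancestor e) (@height_ancestor _ a (b + n)); first lia.
by rewrite -iterD addnC iterD e -iterD addnC.
Qed.

Lemma height_par u : h (par u) = h u - 1.
Proof. exact: (height_iter u 1). Qed.

Lemma height_adj u v : adj u v -> h v = h u - 1 -> v = par u.
Proof. by move=> /adjP[//|->]; rewrite height_par; lia. Qed.

Lemma dist_height u v : (dist u v)%:Z = h u + h v - 2 * h (meet w u v).
Proof.
have [a [b [ea eb ->]]] := meetP u v.
have := congr1 h ea; have := congr1 h eb; rewrite !height_iter; lia.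
Qed.

End Height.

Definition anc m x : Prop := exists n, iter n par x = m.

Lemma anc_refl m : anc m m. Proof. by exists 0%N. Qed.

Lemma anc_trans y x z : anc x y -> anc y z -> anc x z.
Proof. by move=> [a <-] [b <-]; exists (a + b)%N; rewrite iterD. Qed.

Lemma anc_iter u n : anc (iter n par u) u. Proof. by exists n. Qed.

Lemma anc_common u v : exists m, anc m u /\ anc m v.
Proof.
have [a [b e]] := common_ancestor u v.
by exists (iter a par u); split; [exists a|exists b].
Qed.

Lemma anc_dist m x : anc m x -> iter (dist x m) par x = m.
Proof. by move=> [n <-]; rewrite dist_iter. Qed.

(** The least common ancestor of [x] and [y] lies strictly above [m], as otherwise [m] would be an
    ancestor of [x]; so the geodesic from [y] climbs through [m]. *)
Lemma dist_via m x y : anc m y -> ~ anc m x ->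
  dist y x = (dist y m + dist m x)%N.
Proof.
move=> [n nm] nx; have [a [b [e d _]]] := distP y x.
have na : (n < a)%N.
  rewrite ltnNge; apply/negP => an; apply: nx; exists (n - a + b)%N.
  by rewrite iterD -e -iterD subnK.
have ez : iter (a - n) par m = iter b par x.
  by rewrite -e -nm -iterD subnK // ltnW.
have := dist_triangle m y x; have := dist_iter y n; rewrite nm.
have := dist_triangle (iter b par x) m x.
rewrite (distC (iter b par x)) dist_iter -ez.
rewrite dist_iter; lia.
Qed.

(* Below m the geodesics are convex: leaving the descendants of m and coming
   back means crossing m twice. *)
Lemma dist_detour m x y z : anc m y -> anc m z -> ~ anc m x ->
  (dist y z < dist y x + dist x z)%N.
Proof.
move=> my mz nx; rewrite (dist_via my nx) distC (distC x) (dist_via mz nx).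
have := dist_triangle m y z; rewrite (distC y z) (distC m z).
have : dist m x <> 0%N.
  by move/dist_eq0 => e; apply: nx; rewrite -e; exact: anc_refl.
lia.
Qed.

Lemma height_dist_diff o m x y : anc m y -> anc m o -> ~ anc m x ->
  (dist y x)%:Z - (dist o x)%:Z = height o w y.
Proof.
move=> my mo nx; rewrite (dist_via my nx) (dist_via mo nx).
have e := etrans (anc_dist my) (esym (anc_dist mo)).
by rewrite (height_ancestor e); lia.
Qed.

Lemma anc_iter_bound m x : exists N, forall n, (N <= n)%N ->
  ~ anc m (iter n par x).
Proof.
have [[k km]|nm] := pselect (anc m x).
  exists k.+1 => n kn [l]; rewrite -iterD -km => /iter_par_inj; lia.
by exists 0%N => n _ [l]; rewrite -iterD => e; apply: nm; exists (l + n)%N.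
Qed.

(** A path leaving the descendants of [m] passes through [m], and every ray to [w] eventually leaves
    them. *)
Lemma component_not_anc m x : component_at [:: m] w x -> ~ anc m x.
Proof.
move=> [r wr [N _ Nr]] mx.
have [M HM] := anc_iter_bound m (r 0%N).
have [s ps [ls av]] := Nr (maxn N M) (leq_maxl _ _).
apply: (HM (maxn N M) (leq_maxr _ _)); rewrite -end_iterE // -ls.
elim: s x ps {ls Nr} mx av => [|y s IH] x //= /andP[xy ps] [k kx] /andP[xm av].
apply: IH => //; case/adjP: xy => xy; last by exists k.+1; rewrite iterSr -xy.
case: k kx => [|k] kx; first by move: xm; rewrite -kx /= inE eqxx.
by exists k; rewrite xy -iterSr.
Qed.

(** For [m] above [y] and all of [K], the ray from a vertex not below [m] avoids [K]. The vertex [y]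
    allows [m] to be chosen above a base point. *)
Lemma component_of_not_anc (K : seq T) y : exists2 m, anc m y &
  forall x, ~ anc m x -> component_at K w x.
Proof.
suff [m my mK] : exists2 m, anc m y & forall k, k \in K -> anc m k.
  exists m => // x nx; exists (fun n => iter n par x).
    exact: iter_par_end.
  have [a _] := end_ray (iter_par_end x).
  have nK n : iter n par x \notin K.
    apply/negP => /mK mk; apply: nx; apply: anc_trans mk _; exact: anc_iter.
  exists 0%N => // n _; have [p l] := prefix_path n a.
  exists (prefix_seq (fun n => iter n par x) n) => //; split => //=.
  rewrite (nK 0%N) /=; apply/allP => z /mapP[i _ ->]; exact: nK.
elim: K => [|k K [m my mK]]; first by exists y => //; exact: anc_refl.
have [m' [m'm m'k]] := anc_common m k; exists m'; first exact: anc_trans my.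
move=> z; rewrite inE => /orP[/eqP ->//|/mK]; exact: anc_trans.
Qed.

End Ends.

(** * Convergence to ends in terms of ancestors and heights *)

Section EndConvergence.
Variable T : tree.
Implicit Types (w : tree_end T) (u v x y m o : T).

Lemma same_component_sub (K K' : seq T) u v : {subset K <= K'} ->
  same_component K' u v -> same_component K u v.
Proof.
move=> sub [s ps [ls av]]; exists s => //; split => //.
by apply: sub_all av => z; apply: contra; exact: sub.
Qed.

Lemma component_at_sub (K K' : seq T) w : {subset K <= K'} ->
  component_at K' w `<=` component_at K w.
Proof.
move=> sub x [r wr near_r]; exists r => //.
by apply: filterS near_r => n; exact: same_component_sub.
Qed.

Lemma to_end_proper w : ProperFilter (to_end w).
Proof.
apply: filter_from_proper.
  apply: filter_from_filter; first by exists [::].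
  move=> K K' _ _; exists (K ++ K') => // x Kx; split;
    by apply: component_at_sub Kx => z zK; rewrite mem_cat zK ?orbT.
move=> K _; have [r wr] := end_inhabited w.
have [m _ mK] := component_of_not_anc w K (r 0%N).
have [N HN] := anc_iter_bound w m (r 0%N).
by exists (iter N (par w) (r 0%N)); apply/mK/HN.
Qed.

Lemma near_to_end w m : \forall x \near to_end w, ~ anc w m x.
Proof. by exists [:: m] => // x; exact: component_not_anc. Qed.

(** The difference of distances is constant for [x] not below a common ancestor of [u] and [o];
    properness of the filter then determines the limit. *)
Lemma busemann_height (R : realType) o w u :
  busemann R o w u = (height o w u)%:~R.
Proof.
have ? := to_end_proper w; apply: lim_near_cst; first exact: Rhausdorff.
have [m [mu mo]] := anc_common w u o.
have := near_to_end w m; apply: filterS => x nx.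
by rewrite -(height_dist_diff mu mo nx) intrB.
Qed.

Lemma cvg_to_endP w o (x : nat -> T) : x @ \oo --> to_end w <->
  forall m, anc w m o -> \forall n \near \oo, ~ anc w m (x n).
Proof.
split=> [xw m _|nx F [K _ KF]]; first exact: (xw _ (near_to_end w m)).
have [m mo mK] := component_of_not_anc w K o.
by apply: filterS (nx m mo) => n /mK/KF.
Qed.

Lemma cvg_ends_to_end w (w_ : nat -> tree_end T) m :
  w_ @ \oo --> ends_to_end w -> \forall n \near \oo,
  exists2 r, sval (w_ n) r & \forall k \near \oo, ~ anc w m (r k).
Proof.
move=> ww; have : \forall n \near \oo, ends_at [:: m] w (w_ n).
  by apply: ww; exists [:: m].
apply: filterS => n [r wr near_r]; exists r => //.
by apply: filterS near_r => k; exact: component_not_anc.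
Qed.

Lemma ends_to_end_cvg w o (w_ : nat -> tree_end T) :
  (forall m, anc w m o -> \forall n \near \oo,
     exists2 r, sval (w_ n) r & \forall k \near \oo, ~ anc w m (r k)) ->
  w_ @ \oo --> ends_to_end w.
Proof.
move=> H F [K _ KF]; have [m mo mK] := component_of_not_anc w K o.
apply: filterS (H m mo) => n [r wr near_r]; apply: KF; exists r => //.
by apply: filterS near_r => k; exact: mK.
Qed.

Lemma near_height_dist_diff o w (x : nat -> T) y : x @ \oo --> to_end w ->
  \forall n \near \oo, (dist y (x n))%:Z - (dist o (x n))%:Z = height o w y.
Proof.
move=> /(cvg_to_endP w o) xw; have [m [my mo]] := anc_common w y o.
by apply: filterS (xw m mo) => n; exact: height_dist_diff.
Qed.

(** A vertex far out on a ray of [w_ n] lies below [m] neither towards [w] nor below [m'] towards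
    [w_ n], so one difference of distances computes both heights. *)
Lemma near_height_ends o w (w_ : nat -> tree_end T) y :
  w_ @ \oo --> ends_to_end w ->
  \forall n \near \oo, height o (w_ n) y = height o w y.
Proof.
have [m [my mo]] := anc_common w y o => /(cvg_ends_to_end m).
apply: filterS => n [r wr [N _ HN]].
have [m' [m'y m'o]] := anc_common (w_ n) y o.
have [M HM] := anc_iter_bound (w_ n) m' (r 0%N).
have := HM _ (leq_maxr N M); rewrite -end_iterE // => nm'.
rewrite -(height_dist_diff m'y m'o nm').
by apply: height_dist_diff my mo _; apply: HN; exact: leq_maxl.
Qed.

(** The parent is the neighbour of height one less, so heights determine [par], and [par] determines
    the rays. *)
Lemma height_inj o w w' : (forall y, height o w y = height o w' y) -> w = w'.
Proof.
move=> hh; have pp : par w = par w'.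
  apply/funext => u; apply: (height_adj (o := o) (adj_par w u)).
  by rewrite -!hh height_par.
apply: eq_sig_hprop => [E|]; first exact: Prop_irrelevance.
apply/funext => r; apply/propext.
have sub (v v' : tree_end T) : par v = par v' -> sval v r -> sval v' r.
  move=> e vr; suff -> : r = (fun n => iter n (par v') (r 0%N)).
    exact: iter_par_end.
  by rewrite -e; apply/funext => n; exact: end_iterE.
by split; apply: sub.
Qed.

(* The ray from o to w0 stays below some vertex m on the ray from o to w;
   beyond m, every geodesic to w0 passes through m. *)
Lemma near_height_pinfty o w w0 (x : nat -> T) (N : nat) :
  x @ \oo --> to_end w -> w <> w0 ->
  \forall n \near \oo, N%:Z <= height o w0 (x n).
Proof.
move=> xw ww0; pose r n := iter n (par w0) o.
have rw0 : r @ \oo --> to_end w0.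
  apply/(cvg_to_endP w0 o) => m _; have [M HM] := anc_iter_bound w0 m o.
  by exists M.
have [m [mo mr]] : exists m, anc w m o /\ forall n, anc w m (r n).
  (* Otherwise the ray [r] leaves the descendants of every such [m], for good by [dist_detour], so
     it converges to [w] as well and the two heights agree. *)
  apply: contrapT => nm; apply: ww0; apply: (height_inj (o := o)) => y.
  have rw : r @ \oo --> to_end w.
    apply/(cvg_to_endP w o) => m mo.
    have [n nmr] : exists n, ~ anc w m (r n).
      apply: contrapT => all_anc; apply: nm; exists m; split => // n.
      by apply: contrapT => nmr; apply: all_anc; exists n.
    exists n => // l /= nl ml; have := dist_detour mo ml nmr.
    rewrite !dist_iter; have -> : r l = iter (l - n) (par w0) (r n).
      by rewrite -iterD subnK.
    by rewrite dist_iter; lia.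
  have [n [<- <-]] //:= filter_ex (filterI (near_height_dist_diff o y rw)
    (near_height_dist_diff o y rw0)).
(* Not being below [m'] forces [x n] to be at least [N - height o w0 m] away from [m], and this
   distance adds to the height of [m]. *)
pose m' := iter `|N%:Z - height o w0 m|%N (par w) m.
have m'm : anc w m' m by exact: anc_iter.
have m'o := anc_trans m'm mo.
have := (cvg_to_endP w o x).1 xw m' m'o; apply: filterS => n nm'.
have nm : ~ anc w m (x n) by move=> mx; apply: nm'; exact: anc_trans mx.
have [k [<- +]] := filter_ex (filterI (near_height_dist_diff o (x n) rw0)
  (near_height_dist_diff o m rw0)).
rewrite (distC (x n)) (dist_via (mr k) nm) (dist_via m'm nm') (distC m (r k)).
have -> : dist m m' = `|N%:Z - height o w0 m|%N by exact: dist_iter.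
lia.
Qed.

End EndConvergence.

(** * Extraction of subsequences *)

Section Subsequences.

(** The condition may depend on the position [k], which permits diagonal extractions. *)
Lemma choose_subsequence (Q : nat -> nat -> Prop) :
  (forall k N, exists2 n, (N <= n)%N & Q k n) ->
  exists2 phi : nat -> nat, {homo phi : m n / (m < n)%N} &
  forall k, Q k (phi k).
Proof.
move=> H; have /choice[f Hf] : forall kN : nat * nat,
    exists n, (kN.2 <= n)%N /\ Q kN.1 n.
  by move=> [k N]; have [n ? ?] := H k N; exists n.
pose phi := fix phi k := if k is l.+1 then f (k, (phi l).+1) else f (0%N, 0%N).
exists phi => [|[|k]]; last 2 first.
- by case: (Hf (0%N, 0%N)).
- by case: (Hf (k.+1, (phi k).+1)).
apply: homo_ltn; first exact: ltn_trans.
by move=> k; case: (Hf (k.+1, (phi k).+1)).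
Qed.

Lemma frequentlyPn (Q : nat -> Prop) :
  (forall N, exists2 n, (N <= n)%N & Q n) \/
  exists N, forall n, (N <= n)%N -> ~ Q n.
Proof.
have [|nQ] := pselect (forall N, exists2 n, (N <= n)%N & Q n); first by left.
right; apply: contrapT => H; apply: nQ => N; apply: contrapT => nn; apply: H.
by exists N => n Nn Qn; apply: nn; exists n.
Qed.

Lemma frequently_or (P Q : nat -> Prop) :
  (forall N, exists2 n, (N <= n)%N & P n \/ Q n) ->
  (forall N, exists2 n, (N <= n)%N & P n) \/
  (forall N, exists2 n, (N <= n)%N & Q n).
Proof.
move=> PQ; have [|[N nP]] := frequentlyPn P; [by left|right => M].
have [n nNM [Pn|Qn]] := PQ (maxn N M).
  by case: (nP n _ Pn); apply: leq_trans nNM; exact: leq_maxl.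
by exists n => //; apply: leq_trans nNM; exact: leq_maxr.
Qed.

Lemma frequently_pigeonhole (A : eqType) (s : seq A) (Q : A -> nat -> Prop) :
  (forall N, exists2 n, (N <= n)%N & exists2 a, a \in s & Q a n) ->
  exists2 a, a \in s & forall N, exists2 n, (N <= n)%N & Q a n.
Proof.
elim: s => [|a s IH] H; first by have [n _ []] := H 0%N.
have [|Qa|/IH[b bs Qb]] := @frequently_or (Q a)
    (fun n => exists2 b, b \in s & Q b n).
- move=> N; have [n Nn [b]] := H N; rewrite inE => /orP[/eqP->|bs] Qb.
    by exists n => //; left.
  by exists n => //; right; exists b.
- by exists a => //; rewrite inE eqxx.
- by exists b => //; rewrite inE bs orbT.
Qed.

Lemma int_subsequence (i : nat -> int) :
  exists2 phi : nat -> nat, {homo phi : m n / (m < n)%N} &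
  [\/ forall k : nat, k%:Z <= i (phi k), forall k : nat, i (phi k) <= - k%:Z
    | exists c, forall k, i (phi k) = c].
Proof.
have [up|] := pselect (forall k N, exists2 n, (N <= n)%N & k%:Z <= i n).
  by have [phi ? ?] := choose_subsequence up; exists phi => //; exact: Or31.
move=> /existsNP[k nup].
have [//|[N HN]] := frequentlyPn (fun n => k%:Z <= i n).
have [dn|] := pselect (forall k N, exists2 n, (N <= n)%N & i n <= - k%:Z).
  by have [phi ? ?] := choose_subsequence dn; exists phi => //; exact: Or32.
move=> /existsNP[l ndn].
have [//|[M HM]] := frequentlyPn (fun n => i n <= - l%:Z).
(* Bounded on both sides, the sequence eventually takes values in this list of the integers from
   [- l] to [k - 1]. *)
have [|c _ Hc] := @frequently_pigeonhole _
    [seq j%:Z - l%:Z | j <- iota 0 (k + l)] (fun c n => i n = c).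
  move=> K; exists (maxn K (maxn N M)); first exact: leq_maxl.
  set n := maxn _ _; exists (i n) => //.
  have /negP : ~ (k%:Z <= i n) by apply: HN; rewrite /n; lia.
  have /negP : ~ (i n <= - l%:Z) by apply: HM; rewrite /n; lia.
  move=> h1 h2; apply/mapP; exists (absz (i n + l%:Z)); last lia.
  by rewrite mem_iota; lia.
have [phi ? ?] := @choose_subsequence (fun _ n => i n = c) (fun=> Hc).
by exists phi => //; apply: Or33; exists c.
Qed.

End Subsequences.

(** * Sequential compactness by Koenig's lemma *)

Section Compactness.
Variable T : tree.
Hypothesis locally_finite :
  forall u : T, exists s : seq T, forall v, adj u v -> v \in s.
Implicit Types (w : tree_end T) (u v m o : T).

(** A ray from [o] is built through vertices that lie on the geodesics from [o] to infinitely many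
    [x n]; the diagonal subsequence converges to its end. *)
Lemma vertex_compact o (x : nat -> T) : injective x ->
  exists2 phi : nat -> nat, {homo phi : m n / (m < n)%N} &
  exists w, (x \o phi) @ \oo --> to_end w.
Proof.
move=> xi; pose on v n := (dist o v + dist v (x n) = dist o (x n))%N.
pose freq v := forall N, exists2 n, (N <= n)%N & on v n.
have step v : freq v ->
    exists v', [/\ adj v v', dist o v' = (dist o v).+1 & freq v'].
  move=> fv; have [s sP] := locally_finite v.
  have [|v' _ Hv'] := @frequently_pigeonhole _ s
    (fun v' n => [/\ adj v v', dist o v' = (dist o v).+1 & on v' n]).
    move=> N.
    (* The geodesic must continue beyond [v]; by injectivity, an index with [x n = v] can be
       replaced by a later one. *)
    have [n [Nn vn xn]] : exists n, [/\ (N <= n)%N, on v n & x n <> v].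
      have [n Nn vn] := fv N.
      have [xn|xn] := pselect (x n = v); last by exists n.
      have [n' nn' vn'] := fv n.+1; exists n'; split => //; first by lia.
      by rewrite -xn => /xi; lia.
    exists n => //; have [z vz dz] := dist_step (fun e => xn (esym e)).
    exists z; first exact: sP.
    have := dist_triangle z o (x n); have := dist_triangle v o z.
    by have := adj_dist vz; move: vn; rewrite /on => *; split => //; lia.
  exists v'; have [n _ [? ? _]] := Hv' 0%N; split=> // N.
  by have [k Nk []] := Hv' N; exists k.
have /choice[f fP] : forall v, exists v', freq v ->
    [/\ adj v v', dist o v' = (dist o v).+1 & freq v'].
  move=> v; have [/step[v' ?]|nv] := pselect (freq v); first by exists v'.
  by exists v.
pose r n := iter n f o.
have rP n : freq (r n) /\ dist o (r n) = n.
  elim: n => [|n [fr dr]] /=; last by case: (fP _ fr) => _ -> ?; rewrite dr.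
  by split; [move=> N; exists N => //; rewrite /on distuu|exact: distuu].
have ray_r : ray r.
  split=> [n|a b e]; first by case: (fP _ (rP n).1).
  by rewrite -(rP a).2 -(rP b).2 e.
pose w : tree_end T := exist _ [set s | ray s /\ ray_equiv r s]
  (ex_intro2 _ _ r ray_r erefl).
have wr : sval w r by split => //; exists 0%N, 0%N.
have [phi hphi onphi] := @choose_subsequence (fun k n => on (r k) n)
  (fun k => (rP k).1).
exists phi => //; exists w; apply/(cvg_to_endP w o) => m mo.
have [M HM] := anc_iter_bound w m o; exists M => // n /HM nm mx.
(* The geodesic from [o] to the [n]-th term passes through [r n], which would be a strict detour if
   both its endpoints were below [m]. *)
have := dist_detour mo mx nm.
by rewrite -(end_iterE wr n) /= (onphi n) ltnn.
Qed.

(** [vertex_compact] is applied to the vertex at distance [n] from [o] on the ray to [w_ n]; the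
    distances make these vertices distinct. *)
Lemma end_compact o (w_ : nat -> tree_end T) :
  exists2 phi : nat -> nat, {homo phi : m n / (m < n)%N} &
  exists w, (w_ \o phi) @ \oo --> ends_to_end w.
Proof.
pose x n := iter n (par (w_ n)) o.
have [|phi hphi [w xw]] := @vertex_compact o x.
  move=> a b e.
  by rewrite -(dist_iter (w_ a) o a) -(dist_iter (w_ b) o b) -/(x a) e.
exists phi => //; exists w; apply: (ends_to_end_cvg (o := o)) => m mo.
have := (cvg_to_endP w o (x \o phi)).1 xw m mo; apply: filterS => n nm.
exists (fun k => iter k (par (w_ (phi n))) o); first exact: iter_par_end.
(* A geodesic ray from [o] that has left the descendants of [m] cannot return to them. *)
exists (phi n) => // k /= nk mk; have := dist_detour mo mk nm.
have -> : dist o ((x \o phi) n) = phi n by exact: dist_iter.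
rewrite dist_iter.
have -> : iter k (par (w_ (phi n))) o
    = iter (k - phi n) (par (w_ (phi n))) (x (phi n)).
  by rewrite -iterD subnK.
rewrite dist_iter; lia.
Qed.

End Compactness.

(** * Children, siblings and heights in regular trees *)

Section Regular.
Variables (T : tree) (p : nat).
Hypotheses (p_ge2 : (2 <= p)%N) (T_regular : regular p.+1 T).
Implicit Types (w : tree_end T) (u v x o : T).

Lemma regular_locally_finite u : exists s : seq T, forall v, adj u v -> v \in s.
Proof. by have [s [_ _ sP]] := T_regular u; exists s => v; rewrite sP. Qed.

(** Removing the parent from the [p.+1] neighbours leaves at least two, which [adjP] shows to be
    children. *)
Lemma two_children w u : exists c c', [/\ c <> c', par w c = u & par w c' = u].
Proof.
have [s [us sz sP]] := T_regular u.
have ps : par w u \in s by rewrite sP adj_par.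
have := size_rem ps; have := mem_rem_uniq (par w u) us.
have := rem_uniq (par w u) us; rewrite sz /=.
case: (rem _ s) => [|c [|c' t]] /=; [lia|lia|].
move=> /andP[+ _] mem_c _; rewrite inE negb_or => /andP[/eqP cc' _].
exists c, c'; split => //; apply/esym.
  have := mem_c c; rewrite !inE eqxx /= sP => /esym/andP[/eqP cp /(adjP w)].
  by case.
have := mem_c c'; rewrite !inE eqxx orbT /= sP => /esym/andP[/eqP cp /(adjP w)].
by case.
Qed.

Lemma sibling w u : exists2 s, s <> u & par w s = par w u.
Proof.
have [c [c' [cc' pc pc']]] := two_children w (par w u).
have [e|] := pselect (c = u); last by exists c.
by exists c' => // e'; apply: cc'; rewrite e e'.
Qed.

Lemma height_surj o w (k : int) : exists u, height o w u = k.
Proof.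
case: k => n; last first.
  exists (iter n.+1 (par w) o); rewrite height_iter height_root; lia.
elim: n => [|n [u hu]]; first by exists o; rewrite height_root.
have [c [_ [_ pc _]]] := two_children w u; exists c.
have := height_par w o c; rewrite pc hu; lia.
Qed.

End Regular.

(** * Divergence of integer sequences *)

Section IntegerLimits.
Variable R : realType.
Implicit Types i : nat -> int.

Lemma cvg_int_pinfty i : ((i n)%:~R : R) @[n --> \oo] --> +oo <->
  forall N : nat, \forall n \near \oo, N%:Z <= i n.
Proof.
split=> [/cvgryPge H N|H].
  by apply: filterS (H N%:R) => n; rewrite pmulrn ler_int.
apply/cvgryPge => A; apply: filterS (H (Num.bound `|A|)) => n.
rewrite -(ler_int R) -pmulrn; apply: le_trans.
by rewrite (le_trans (ler_norm A)) // ltW // archi_boundP.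
Qed.

Lemma cvg_int_ninfty i : ((i n)%:~R : R) @[n --> \oo] --> -oo <->
  forall N : nat, \forall n \near \oo, i n <= - N%:Z.
Proof.
split=> [/cvgrNyPle H N|H].
  by apply: filterS (H (- N%:R)) => n; rewrite pmulrn -intrN ler_int.
apply/cvgrNyPle => A; apply: filterS (H (Num.bound `|A|)) => n.
rewrite -(ler_int R) intrN -pmulrn => /le_trans; apply.
by rewrite lerNl (le_trans (ler_norm _)) // normrN ltW // archi_boundP.
Qed.

End IntegerLimits.

(** * Pointwise convergence and integer values *)

Section PointwiseTopology.
Variables (R : realType) (I : Type).
Implicit Types (f g : {ptws I -> R}).

Lemma ptws_cvgP (F : set_system {ptws I -> R}) f : Filter F ->
  F --> f <-> forall y, g y @[g --> F] --> f y.
Proof.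
(* Constant functions make every evaluation surjective, as [cvg_image] requires. *)
move=> FF; have surj y : (fun g : {ptws I -> R} => g y) @` setT = setT.
  by rewrite eqEsubset; split=> v // _; exists (fun=> v).
split=> [/cvg_sup H y|H].
  have /cvg_image := H y => /(_ (surj y)) Hy.
  apply: cvg_trans Hy => Q /= [W FW <-].
  by apply: (@filterS _ F _ W) => // g Wg; exists g.
apply/cvg_sup => y; apply/cvg_image; first exact: surj.
move=> Q /H Q'; exists ((fun g : {ptws I -> R} => g y) @^-1` Q) => //.
by rewrite image_preimage.
Qed.

Lemma near_ptws_cvg (s : nat -> {ptws I -> R}) f :
  (forall y, \forall n \near \oo, s n y = f y) -> s @ \oo --> f.
Proof. by move=> H; apply/ptws_cvgP => y; apply: cvg_near_cst; exact: H. Qed.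

(** Distinct integers are at distance at least 1. Quantifying over [l] leaves open whether a nearby
    [g] is integer valued. *)
Lemma nbhs_int_valued f y (k : int) : f y = k%:~R ->
  \forall g \near f, forall l : int, g y = l%:~R -> l = k.
Proof.
move=> fy; have f_filter : Filter (nbhs f) by exact: nbhs_filter.
have /ptws_cvgP/(_ y)/cvgrPdist_lt/(_ 1 ltr01) near_f : nbhs f --> f by [].
apply: filterS near_f => g + l gy; rewrite /= fy gy -intrB -intr_norm.
rewrite -[1]/(1%:~R) ltr_int; lia.
Qed.

End PointwiseTopology.

(** * Vertex functions and their characterization by four values *)

Section VertexFunction.
Variables (T : tree) (o : T) (w0 : tree_end T).
Implicit Types (u x y : T).
Local Notation h := (height o w0).

(** This is [dist u x] minus twice the maximum of [h u] and [h x]; [dist_height] has eliminated the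
    meet. *)
Definition vertex_value x u : int :=
  (dist u x)%:Z - h u - h x - `|h u - h x|.

Lemma vertex_funE (R : realType) x u :
  vertex_fun R o w0 x u = (vertex_value x u)%:~R.
Proof.
by rewrite /vertex_fun /vertex_value (dist_height w0 o u x); congr intmul; lia.
Qed.

Lemma vertex_value_diff c x y : (dist y x)%:Z - (dist o x)%:Z = c ->
  vertex_value x y - vertex_value x o = c - h y - `|h y - h x| + `|h x|.
Proof. by rewrite /vertex_value height_root; lia. Qed.

(** The geodesic from [c] begins by going up, since otherwise [c] would be the least common
    ancestor. *)
Lemma dist_child_not_anc c x : ~ anc w0 c x ->
  dist c x = (dist (par w0 c) x).+1.
Proof.
move=> nx; have [m [mc mx]] := anc_common w0 c x.
have [a [b [e d _]]] := distP w0 c x.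
case: a e d => [|a] e d; first by case: nx; exists b.
have := dist_triangle (par w0 c) c x; have := adj_dist (adj_par w0 c).
have := dist_triangle (iter b (par w0) x) (par w0 c) x.
rewrite (distC (iter b _ x)) dist_iter -e iterSr dist_iter; lia.
Qed.

Section Characterization.
Variables x0 s c c' : T.
Hypotheses (s_x0 : s <> x0) (par_s : par w0 s = par w0 x0).
Hypotheses (c_c' : c <> c') (par_c : par w0 c = x0) (par_c' : par w0 c' = x0).

Let heights : [/\ h s = h x0, h c = h x0 + 1 & h c' = h x0 + 1].
Proof.
have := height_par w0 o s; have := height_par w0 o x0; rewrite par_s.
have := height_par w0 o c; have := height_par w0 o c'; rewrite par_c par_c'.
by split; lia.
Qed.

Let not_anc_s : ~ anc w0 s x0.
Proof.
case: heights => hs _ _ [n nx].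
have := height_iter w0 o x0 n; rewrite nx hs => e.
by apply: s_x0; rewrite -nx; have -> : n = 0%N by lia.
Qed.

Let values : [/\ vertex_value x0 s = vertex_value x0 x0 + 2,
  vertex_value x0 c = vertex_value x0 x0 - 1 &
  vertex_value x0 c' = vertex_value x0 x0 - 1].
Proof.
case: heights => hs hc hc'; rewrite /vertex_value hs hc hc' distuu.
rewrite (dist_child_not_anc not_anc_s) par_s distC.
have := dist_iter w0 x0 1; have := dist_iter w0 c 1; have := dist_iter w0 c' 1.
by rewrite /= par_c par_c' => -> -> ->; split; lia.
Qed.

(** This rules out functions of the height or of the other tree, which do not separate [x0] from [s]
    over a common vertex. *)
Lemma vertex_value_sibling : vertex_value x0 s <> vertex_value x0 x0.
Proof. by case: values; lia. Qed.

(** Both children would be one lower than [x0] relative to [w], hence both the parent of [x0]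
    towards [w]. *)
Lemma end_not_vertex_value w k : height o w x0 = vertex_value x0 x0 + k ->
  height o w c = vertex_value x0 c + k ->
  height o w c' = vertex_value x0 c' + k -> False.
Proof.
case: values => _ vc vc' e0 ec ec'; apply: c_c'.
have adjc : adj x0 c by rewrite tree_sym -par_c adj_par.
have adjc' : adj x0 c' by rewrite tree_sym -par_c' adj_par.
rewrite (height_adj (o := o) (w := w) adjc); last lia.
rewrite (height_adj (o := o) (w := w) adjc') //; lia.
Qed.

Lemma vertex_value_inj x k : vertex_value x s = vertex_value x0 s + k ->
  vertex_value x x0 = vertex_value x0 x0 + k ->
  vertex_value x c = vertex_value x0 c + k ->
  vertex_value x c' = vertex_value x0 c' + k -> x = x0.
Proof.
case: values => vs vc vc'; rewrite vs vc vc' => es e0 ec ec'.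
case: heights => hs hc hc'.
(* If [x] were not below [x0], it would be at most as far from [s] as from [x0], against the larger
   value at [s]. *)
have [b bx] : anc w0 x0 x.
  apply: contrapT => nx; have := dist_child_not_anc nx; rewrite -par_s.
  have := dist_triangle (par w0 s) s x; have := adj_dist (adj_par w0 s).
  move: es e0; rewrite /vertex_value hs; lia.
have hx := height_iter w0 o x b; rewrite bx in hx.
case: b bx hx => [|b] // bx hx; exfalso.
(* Now [x] is strictly below [x0], so the maximum of the heights is [h x] at [x0] and at its
   children; a drop in value is then a drop in distance. *)
have anc_child z : par w0 z = x0 -> h z = h x0 + 1 ->
    vertex_value x z = vertex_value x x0 - 1 -> anc w0 z x.
  move=> pz hz vz; apply: contrapT => /dist_child_not_anc; rewrite pz.
  by move: vz; rewrite /vertex_value hz; lia.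
have [n nx] : anc w0 c x by apply: anc_child => //; lia.
have [n' n'x] : anc w0 c' x by apply: anc_child => //; lia.
apply: c_c'; rewrite -nx -n'x; congr (iter _ _ x).
have := height_iter w0 o x n; have := height_iter w0 o x n'.
rewrite nx n'x; lia.
Qed.

(* The three alternatives of [A_values] are the ends of T, the vertices of T,
   and the functions of the height in T or of the vertex of T'. *)
Lemma isolated_vertex_value (R : realType) (I : Type) (pr : I -> T)
    (A : set {ptws I -> R}) (f0 : {ptws I -> R}) (a b d d' : I) :
  pr a = x0 -> pr b = s -> pr d = c -> pr d' = c' -> A f0 ->
  (forall i, f0 i = (vertex_value x0 (pr i) - vertex_value x0 o)%:~R) ->
  (forall f, A f -> [\/ exists w, forall i, f i = (height o w (pr i))%:~R,
    exists x, forall i, f i = (vertex_value x (pr i) - vertex_value x o)%:~R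
    | exists2 k : int, f a = k%:~R & f b = k%:~R]) ->
  isolated A f0.
Proof.
move=> pa pb pd pd' Af0 f0E A_values; split; first exact/mem_set.
pose near_at i := [set f : {ptws I -> R} | forall l : int, f i = l%:~R ->
  l = vertex_value x0 (pr i) - vertex_value x0 o].
have near_atP i : nbhs f0 (near_at i) by apply: nbhs_int_valued; exact: f0E.
exists (near_at a `&` near_at b `&` near_at d `&` near_at d').
  by do !apply: filterI.
rewrite eqEsubset; split=> [f [[[[fa fb] fd] fd'] /A_values]|_ ->]; last first.
  have near_f0 i : near_at i f0.
    by move=> l; rewrite f0E => /eqP; rewrite eqr_int => /eqP.
  by split.
case=> [[w fE]|[x fE]|[k ka kb]].
- exfalso; apply: (@end_not_vertex_value w (- vertex_value x0 o)).
  + by have := fa _ (fE _); rewrite pa.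
  + by have := fd _ (fE _); rewrite pd.
  + by have := fd' _ (fE _); rewrite pd'.
- have xx0 : x = x0.
    (* The constant is the difference between the normalizations at [o]. *)
    apply: (@vertex_value_inj x (vertex_value x o - vertex_value x0 o)).
    + by have := fb _ (fE _); rewrite pb; lia.
    + by have := fa _ (fE _); rewrite pa; lia.
    + by have := fd _ (fE _); rewrite pd; lia.
    + by have := fd' _ (fE _); rewrite pd'; lia.
  by apply/funext => i; rewrite fE f0E xx0.
- exfalso; apply: vertex_value_sibling.
  by have := fa _ ka; have := fb _ kb; rewrite pa pb; lia.
Qed.

End Characterization.

End VertexFunction.

(** * Subsequences of distinct vertices *)

Section VertexSubsequence.
Variables (R : realType) (T : tree) (o : T) (w0 : tree_end T).
Local Notation h := (height o w0).

Lemma cvg_dist_root w (x : nat -> T) : x @ \oo --> to_end w ->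
  dist (x n) o @[n --> \oo] --> \oo.
Proof.
move=> /(cvg_to_endP w o) xw; apply/cvgnyPge => N.
apply: filterS (xw _ (anc_iter w o N)) => n nx.
by rewrite distC (dist_via (anc_iter w o N) nx) dist_iter leq_addr.
Qed.

(** The descendants of [m] at height [i] are [i + k] steps below [m], hence within [i + k + k] of
    [o]. *)
Lemma cvg_level (x : nat -> T) i : (forall n, h (x n) = i) ->
  dist (x n) o @[n --> \oo] --> \oo -> x @ \oo --> to_end w0.
Proof.
move=> hx /cvgnyPge dx; apply/(cvg_to_endP w0 o) => m [k km].
apply: filterS (dx (absz i + k + k).+1) => n dn [l lm].
have := height_ancestor (etrans lm (esym km)); rewrite hx.
have := dist_triangle m (x n) o; have := dist_iter w0 (x n) l.
have := dist_iter w0 o k; rewrite km lm (distC m o).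
move: dn; lia.
Qed.

Lemma vertex_subsequence
    (locally_finite :
      forall u : T, exists s : seq T, forall v, adj u v -> v \in s)
    (x : nat -> T) : injective x ->
  exists2 phi : nat -> nat, {homo phi : m n / (m < n)%N} &
  [\/ exists2 w, (x \o phi) @ \oo --> to_end w & w <> w0,
      (x \o phi) @ \oo --> to_end w0 /\
        ((h (x (phi n)))%:~R : R) @[n --> \oo] --> +oo,
      (x \o phi) @ \oo --> to_end w0 /\
        ((h (x (phi n)))%:~R : R) @[n --> \oo] --> -oo
    | dist (x (phi n)) o @[n --> \oo] --> \oo /\
        exists i, forall n, h (x (phi n)) = i].
Proof.
move=> xi; have [phi hphi [w xw]] := vertex_compact locally_finite o xi.
have [|ww0] := pselect (w <> w0).
  by exists phi => //; apply: Or41; exists w.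
move/contrapT: ww0 => ww0; rewrite {w}ww0 in xw.
(* Towards [w0] the limit type depends on the heights, so a second extraction sorts these. *)
have [psi hpsi hh] := int_subsequence (h \o x \o phi).
exists (phi \o psi); first by move=> m n /hpsi/hphi.
have xw' : (x \o phi \o psi) @ \oo --> to_end w0.
  apply/(cvg_to_endP w0 o) => m mo.
  have [N _ HN] := (cvg_to_endP w0 o (x \o phi)).1 xw m mo.
  exists N => // n /= Nn; apply: HN => /=; apply: leq_trans Nn _.
  by elim: n => // n IH; apply: leq_ltn_trans IH _; exact: hpsi.
case: hh => [up|dn|[i ci]].
- apply: Or42; split=> //; apply/cvg_int_pinfty => N.
  by exists N => // n /= Nn; have := up n => /=; lia.
- apply: Or43; split=> //; apply/cvg_int_ninfty => N.
  by exists N => // n /= Nn; have := dn n => /=; lia.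
- by apply: Or44; split; [exact: cvg_dist_root xw'|exists i].
Qed.

End VertexSubsequence.

(** * Eventual values of normalized vertex functions *)

Section VertexLimits.
Variables (T : tree) (o : T) (w0 : tree_end T).
Local Notation h := (height o w0).
Local Notation value := (vertex_value o w0).

(** Once [h (x n)] exceeds the absolute value of [h u], both maxima of heights, at [u] and at [o],
    are [h (x n)] and cancel. *)
Lemma near_vertex_pinfty w (x : nat -> T) u : x @ \oo --> to_end w ->
  (forall N : nat, \forall n \near \oo, N%:Z <= h (x n)) ->
  \forall n \near \oo, value (x n) u - value (x n) o = height o w u.
Proof.
move=> xw hx; apply: filterS2 (near_height_dist_diff o u xw) (hx (absz (h u))).
by move=> n /vertex_value_diff -> hn; lia.
Qed.

(** The maxima are now [h u] and 0, leaving [h u - 2 * h u]. On DL this is the height in the other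
    tree. *)
Lemma near_vertex_ninfty (x : nat -> T) u : x @ \oo --> to_end w0 ->
  (forall N : nat, \forall n \near \oo, h (x n) <= - N%:Z) ->
  \forall n \near \oo, value (x n) u - value (x n) o = - h u.
Proof.
move=> xw hx; apply: filterS2 (near_height_dist_diff o u xw) (hx (absz (h u))).
by move=> n /vertex_value_diff -> hn; lia.
Qed.

Lemma near_vertex_level (x : nat -> T) i u :
  dist (x n) o @[n --> \oo] --> \oo ->
  (forall n, h (x n) = i) ->
  \forall n \near \oo, value (x n) u - value (x n) o = `|i| - `|h u - i|.
Proof.
move=> dx hx; apply: filterS (near_height_dist_diff o u (cvg_level hx dx)).
by move=> n /vertex_value_diff ->; rewrite hx; lia.
Qed.

End VertexLimits.

(** * The horoboundary of DL *)

Section Horoboundary.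
Variables (R : realType) (T T' : tree).
Variables (o : T) (w0 : tree_end T) (o' : T') (w0' : tree_end T').
Local Notation DL := (DL o w0 o' w0').
Local Notation hT y := (height o w0 (sval y).1).
Local Notation hT' y := (height o' w0' (sval y).2).
Local Notation rho_end := (rho_end R o w0 o' w0').
Local Notation rho_end' := (rho_end' R o w0 o' w0').
Local Notation rho_vertex := (rho_vertex R o w0 o' w0').
Local Notation rho_vertex' := (rho_vertex' R o w0 o' w0').
Local Notation rho_level := (rho_level R o w0 o' w0').
Local Notation horoboundary := (horoboundary R o w0 o' w0').
Implicit Types (y : DL) (s : nat -> {ptws DL -> R}).

Lemma rho_endE w y : rho_end w y = (height o w (sval y).1)%:~R.
Proof. by rewrite /rho_end /normalize !busemann_height height_root subr0. Qed.

Lemma rho_end'E w y : rho_end' w y = (height o' w (sval y).2)%:~R.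
Proof. by rewrite /rho_end' /normalize !busemann_height height_root subr0. Qed.

Lemma rho_vertexE x y : rho_vertex x y =
  (vertex_value o w0 x (sval y).1 - vertex_value o w0 x o)%:~R.
Proof. by rewrite /rho_vertex /normalize !vertex_funE intrB. Qed.

Lemma rho_vertex'E x y : rho_vertex' x y =
  (vertex_value o' w0' x (sval y).2 - vertex_value o' w0' x o')%:~R.
Proof. by rewrite /rho_vertex' /normalize !vertex_funE intrB. Qed.

Lemma rho_levelE i y : rho_level i y = (`|i| - `|hT y - i|)%:~R.
Proof.
rewrite /rho_level /normalize /level_fun height_root -intrB; congr intmul; lia.
Qed.

Lemma heights_opp y : hT' y = - hT y.
Proof. by have := svalP y => /=; lia. Qed.

(** In each case the integer values at a given point eventually equal that of the limit. *)
Lemma limit_type_cvg s (l : {ptws DL -> R}) : limit_type s l -> s @ \oo --> l.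
Proof.
case.
- move=> i /cvg_int_pinfty hi; apply: near_ptws_cvg => y.
  apply: filterS (hi (absz (hT y))) => n hn.
  by rewrite rho_levelE rho_endE; congr intmul; lia.
- move=> i /cvg_int_ninfty hi; apply: near_ptws_cvg => y.
  apply: filterS (hi (absz (hT y))) => n hn.
  by rewrite rho_levelE rho_end'E heights_opp; congr intmul; lia.
- move=> w_ w ww; apply: near_ptws_cvg => y.
  apply: filterS (near_height_ends o (sval y).1 ww) => n hn.
  by rewrite !rho_endE hn.
- move=> w_ w ww; apply: near_ptws_cvg => y.
  apply: filterS (near_height_ends o' (sval y).2 ww) => n hn.
  by rewrite !rho_end'E hn.
- move=> x w xw ww0; apply: near_ptws_cvg => y.
  have hx N := near_height_pinfty o N xw ww0.
  apply: filterS (near_vertex_pinfty (sval y).1 xw hx) => n hn.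
  by rewrite rho_vertexE rho_endE hn.
- move=> x xw /cvg_int_pinfty hx; apply: near_ptws_cvg => y.
  apply: filterS (near_vertex_pinfty (sval y).1 xw hx) => n hn.
  by rewrite rho_vertexE rho_endE hn.
- move=> x xw /cvg_int_ninfty hx; apply: near_ptws_cvg => y.
  apply: filterS (near_vertex_ninfty (sval y).1 xw hx) => n hn.
  by rewrite rho_vertexE rho_end'E hn heights_opp.
- move=> x i dx hx; apply: near_ptws_cvg => y.
  apply: filterS (near_vertex_level (sval y).1 dx hx) => n hn.
  by rewrite rho_vertexE rho_levelE hn.
- move=> x w xw ww0; apply: near_ptws_cvg => y.
  have hx N := near_height_pinfty o' N xw ww0.
  apply: filterS (near_vertex_pinfty (sval y).2 xw hx) => n hn.
  by rewrite rho_vertex'E rho_end'E hn.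
- move=> x xw /cvg_int_pinfty hx; apply: near_ptws_cvg => y.
  apply: filterS (near_vertex_pinfty (sval y).2 xw hx) => n hn.
  by rewrite rho_vertex'E rho_end'E hn.
- move=> x xw /cvg_int_ninfty hx; apply: near_ptws_cvg => y.
  apply: filterS (near_vertex_ninfty (sval y).2 xw hx) => n hn.
  by rewrite rho_vertex'E rho_endE hn heights_opp opprK.
- move=> x i dx hx; apply: near_ptws_cvg => y.
  apply: filterS (near_vertex_level (sval y).2 dx hx) => n hn.
  by rewrite rho_vertex'E rho_levelE hn heights_opp; congr intmul; lia.
Qed.

Section Regularity.
Variables p q : nat.
Hypotheses (p_ge2 : (2 <= p)%N) (q_ge2 : (2 <= q)%N).
Hypotheses (T_regular : regular p.+1 T) (T'_regular : regular q.+1 T').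

Lemma isolated_rho_vertex x0 : isolated horoboundary (rho_vertex x0).
Proof.
have [s sx0 ps] := sibling p_ge2 T_regular w0 x0.
have [c [c' [cc' pc pc']]] := two_children p_ge2 T_regular w0 x0.
(* One [v] lies over both [x0] and [s], and one [z] over both children, as these pairs have equal
   heights. *)
have [v hv] := height_surj q_ge2 T'_regular o' w0' (- height o w0 x0).
have [z hz] := height_surj q_ge2 T'_regular o' w0' (- height o w0 c).
have hs : height o w0 s = height o w0 x0.
  by have := height_par w0 o s; have := height_par w0 o x0; rewrite ps; lia.
have hc' : height o w0 c' = height o w0 c.
  have := height_par w0 o c; have := height_par w0 o c'; rewrite pc pc'; lia.
have [a_DL b_DL d_DL d'_DL] : [/\ height o w0 x0 + height o' w0' v = 0,
    height o w0 s + height o' w0' v = 0, height o w0 c + height o' w0' z = 0 &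
    height o w0 c' + height o' w0' z = 0].
  by rewrite hv hz hs hc'; split; lia.
apply: (isolated_vertex_value sx0 ps cc' pc pc' (pr := fun y => (sval y).1)
  (a := exist _ (x0, v) a_DL : DL) (b := exist _ (s, v) b_DL : DL)
  (d := exist _ (c, z) d_DL : DL) (d' := exist _ (c', z) d'_DL : DL)) => //.
- by left; left; right; exists x0.
- exact: rho_vertexE.
- move=> f [[[[]|]|]|] [t _ <-].
  + by apply: Or31; exists t; exact: rho_endE.
  + by apply: Or33; exists (height o' t v); rewrite rho_end'E.
  + by apply: Or32; exists t; exact: rho_vertexE.
  + apply: Or33; exists (vertex_value o' w0' t v - vertex_value o' w0' t o');
      by rewrite rho_vertex'E.
  + by apply: Or33; exists (`|t| - `|height o w0 x0 - t|);
      rewrite rho_levelE //= hs.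
Qed.

Lemma isolated_rho_vertex' x0 : isolated horoboundary (rho_vertex' x0).
Proof.
have [s sx0 ps] := sibling q_ge2 T'_regular w0' x0.
have [c [c' [cc' pc pc']]] := two_children q_ge2 T'_regular w0' x0.
have [v hv] := height_surj p_ge2 T_regular o w0 (- height o' w0' x0).
have [z hz] := height_surj p_ge2 T_regular o w0 (- height o' w0' c).
have hs : height o' w0' s = height o' w0' x0.
  by have := height_par w0' o' s; have := height_par w0' o' x0; rewrite ps; lia.
have hc' : height o' w0' c' = height o' w0' c.
  have := height_par w0' o' c; have := height_par w0' o' c'.
  rewrite pc pc'; lia.
have [a_DL b_DL d_DL d'_DL] : [/\ height o w0 v + height o' w0' x0 = 0,
    height o w0 v + height o' w0' s = 0, height o w0 z + height o' w0' c = 0 &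
    height o w0 z + height o' w0' c' = 0].
  by rewrite hv hz hs hc'; split; lia.
apply: (isolated_vertex_value sx0 ps cc' pc pc' (pr := fun y => (sval y).2)
  (a := exist _ (v, x0) a_DL : DL) (b := exist _ (v, s) b_DL : DL)
  (d := exist _ (z, c) d_DL : DL) (d' := exist _ (z, c') d'_DL : DL)) => //.
- by left; right; exists x0.
- exact: rho_vertex'E.
- move=> f [[[[]|]|]|] [t _ <-].
  + by apply: Or33; exists (height o t v); rewrite rho_endE.
  + by apply: Or31; exists t; exact: rho_end'E.
  + apply: Or33; exists (vertex_value o w0 t v - vertex_value o w0 t o);
      by rewrite rho_vertexE.
  + by apply: Or32; exists t; exact: rho_vertex'E.
  + by apply: Or33; exists (`|t| - `|height o w0 v - t|); rewrite rho_levelE.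
Qed.

Lemma range_subsequence A (g : A -> {ptws DL -> R}) s :
  (forall N, exists2 n, (N <= n)%N & range g (s n)) -> injective s ->
  exists2 phi : nat -> nat, {homo phi : m n / (m < n)%N} &
  exists2 x : nat -> A, injective x & s \o phi = g \o x.
Proof.
move=> gs si.
have [phi hphi rphi] :=
  @choose_subsequence (fun _ n => range g (s n)) (fun=> gs).
have /choice[x gx] : forall k, exists x, g x = s (phi k).
  by move=> k; have [x _ <-] := rphi k; exists x.
exists phi => //; exists x; last by apply/funext => k /=; rewrite gx.
move=> a b e; have /si : s (phi a) = s (phi b) by rewrite -!gx e.
by have [/hphi|/hphi|//] := ltngtP a b; lia.
Qed.

Lemma horoboundary_subsequence s :
  (forall n, horoboundary (s n)) -> injective s ->
  exists phi : nat -> nat, {homo phi : m n / (m < n)%N} /\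
    exists l, limit_type (s \o phi) l.
Proof.
move=> sH si.
(* One of the five families is met infinitely often; [pull] reduces the extraction to its
   parameters, which inherit injectivity from [s]. *)
have pull A (g : A -> {ptws DL -> R}) :
    (forall N, exists2 n, (N <= n)%N & range g (s n)) ->
    (forall x : nat -> A, injective x -> exists2 psi : nat -> nat,
       {homo psi : m n / (m < n)%N} & exists l, limit_type (g \o x \o psi) l) ->
    exists phi : nat -> nat, {homo phi : m n / (m < n)%N} /\
      exists l, limit_type (s \o phi) l.
  move=> /range_subsequence/(_ si)[phi hphi [x xi e]].
  move=> /(_ x xi)[psi hpsi [l lim_l]].
  exists (phi \o psi); split; first by move=> m n /hpsi/hphi.
  by exists l; move: lim_l; rewrite -e.
have sN N : exists2 n, (N <= n)%N & horoboundary (s n) by exists N.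
case: (frequently_or sN) => {}sN; last first.
  apply: pull sN _ => i ii; have [psi hpsi hh] := int_subsequence i.
  exists psi => //; case: hh => [up|dn|[c ci]].
  - exists (rho_end w0); apply: lim_level_pinfty; apply/cvg_int_pinfty => N.
    by exists N => // n /= Nn; have := up n; lia.
  - exists (rho_end' w0'); apply: lim_level_ninfty; apply/cvg_int_ninfty => N.
    by exists N => // n /= Nn; have := dn n; lia.
  (* Distinct levels admit no constant subsequence. *)
  - have /ii : i (psi 0%N) = i (psi 1%N) by rewrite !ci.
    by have := hpsi 0%N 1%N; lia.
case: (frequently_or sN) => {}sN; last first.
  apply: pull sN _ => x xi.
  have [psi hpsi lim_x] := vertex_subsequence R o' w0'
    (regular_locally_finite T'_regular) xi.
  exists psi => //; case: lim_x => [[w xw ww0]|[xw hx]|[xw hx]|[dx [i hi]]].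
  - by exists (rho_end' w); exact: lim_vertex'_end.
  - by exists (rho_end' w0'); exact: lim_vertex'_pinfty.
  - by exists (rho_end w0); exact: lim_vertex'_ninfty.
  - by exists (rho_level (- i)); exact: lim_vertex'_level.
case: (frequently_or sN) => {}sN; last first.
  apply: pull sN _ => x xi.
  have [psi hpsi lim_x] := vertex_subsequence R o w0
    (regular_locally_finite T_regular) xi.
  exists psi => //; case: lim_x => [[w xw ww0]|[xw hx]|[xw hx]|[dx [i hi]]].
  - by exists (rho_end w); exact: lim_vertex_end.
  - by exists (rho_end w0); exact: lim_vertex_pinfty.
  - by exists (rho_end' w0'); exact: lim_vertex_ninfty.
  - by exists (rho_level i); exact: lim_vertex_level.
case: (frequently_or sN) => {}sN.
  apply: pull sN _ => w_ _.
  have [psi hpsi [w ww]] := end_compact (regular_locally_finite T_regular) o w_.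
  by exists psi => //; exists (rho_end w); exact: lim_end ww.
apply: pull sN _ => w_ _.
have [psi hpsi [w ww]] := end_compact (regular_locally_finite T'_regular) o' w_.
by exists psi => //; exists (rho_end' w); exact: lim_end' ww.
Qed.

End Regularity.

End Horoboundary.

Theorem proposition6p5 (R : realType) (p q : nat) (T T' : tree)
    (o : T) (w0 : tree_end T) (o' : T') (w0' : tree_end T') :
  (2 <= p)%N -> (2 <= q)%N -> regular p.+1 T -> regular q.+1 T' ->
  [/\ forall x0 : T,
        isolated (horoboundary R o w0 o' w0') (rho_vertex R o w0 o' w0' x0),
      forall x0' : T',
        isolated (horoboundary R o w0 o' w0') (rho_vertex' R o w0 o' w0' x0'),
      forall (s : nat -> {ptws DL o w0 o' w0' -> R})
          (l : {ptws DL o w0 o' w0' -> R}),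
        limit_type s l -> s @ \oo --> l
    & forall s : nat -> {ptws DL o w0 o' w0' -> R},
        (forall n, horoboundary R o w0 o' w0' (s n)) -> injective s ->
        exists phi : nat -> nat, {homo phi : m n / (m < n)%N} /\
          exists l, limit_type (s \o phi) l].
Proof.
move=> p_ge2 q_ge2 T_regular T'_regular; split.
- exact: isolated_rho_vertex p_ge2 q_ge2 T_regular T'_regular.
- exact: isolated_rho_vertex' p_ge2 q_ge2 T_regular T'_regular.
- exact: limit_type_cvg.
- exact: horoboundary_subsequence T_regular T'_regular.
Qed.
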